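(* Let $k\in\mathbb{N}$ and $S=\langle 4k+7,4k+9,4k+13,4k+15\rangle$. Then \[\mathrm{Ap}(S,4k+7)=\{a(4k+9)+b(4k+13)+c(4k+15)\mid (a,b,c)\in C\},\] where $C=C_a\cup C_b\cup C_c$ with $C_a=\big(\{1\}\times\{0\}\times\{0,1,\dots,k+1\}\big)\cup\{(2,0,0)\}$, $C_b=\{0\}\times\{1,2\}\times\{0,1,\dots,k\}$, and $C_c=\{0\}\times\{0\}\times\{0,1,\dots,k+1\}$.
   Context: $\mathbb{N}=\{0,1,2,\dots\}$. For $X\subseteq\mathbb{N}$, $\langle X\rangle$ is the submonoid of $(\mathbb{N},+)$ generated by $X$; here it is a numerical semigroup. For a numerical semigroup $S$ and $n\in S\setminus\{0\}$, the Apéry set is $\mathrm{Ap}(S,n)=\{s\in S\mid s-n\notin S\}$. *)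

(* Defs.v *)
From mathcomp Require Import all_boot.
From mathcomp Require Import classical_sets.

Set Implicit Arguments.
Unset Strict Implicit.
Unset Printing Implicit Defensive.

Local Open Scope classical_set_scope.
Local Open Scope nat_scope.

Definition is_submonoid (M : set nat) : Prop :=
  M 0 /\ (forall x y : nat, M x -> M y -> M (x + y)).

Definition submonoid_gen (X : set nat) : set nat := smallest is_submonoid X.

(* The difference s - n is the integer one: for s < n it is negative, hence not
   in S, whereas truncated subtraction would give 0, which is in S. *)
Definition Apery (S : set nat) (n : nat) : set nat :=
  [set s | S s /\ ~ (n <= s /\ S (s - n))].

Definition sgS (k : nat) : set nat :=
  submonoid_gen [set 4 * k + 7; 4 * k + 9; 4 * k + 13; 4 * k + 15].

(* Triples (a, b, c) are left-nested pairs, matching the left-associative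
   product of sets. *)
Definition Ca (k : nat) : set (nat * nat * nat) :=
  ([set 1] `*` [set 0] `*` [set c | c <= k + 1]) `|` [set (2, 0, 0)].

Definition Cb (k : nat) : set (nat * nat * nat) :=
  [set 0] `*` [set 1; 2] `*` [set c | c <= k].

Definition Cc (k : nat) : set (nat * nat * nat) :=
  [set 0] `*` [set 0] `*` [set c | c <= k + 1].

Definition Cset (k : nat) : set (nat * nat * nat) := Ca k `|` Cb k `|` Cc k.

(* Main.v *)
Require Import Defs.
From mathcomp Require Import all_boot.
From mathcomp Require Import classical_sets.
From mathcomp Require Import zify.

Local Open Scope classical_set_scope.
Local Open Scope nat_scope.

(** With m = 4k+7 the generators are m + 2u for u in {0, 1, 3, 4}.  A sum of t
    elements of {0, 1, 3, 4} can be any w <= 4t, except 2 when t = 1, so S is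
    the set of all t m + 2 w for such pairs (t, w).  Two pairs represent the
    same number iff they differ by a multiple of (-2, m), since m is odd.
    Hence the elements of the Apery set are those with w < m and t minimal for
    w, and C lists the corresponding decompositions of w. *)

Definition admissible (t w : nat) : Prop := w <= 4 * t /\ ~ (t = 1 /\ w = 2).

Lemma submonoid_gen_incl (X : set nat) (x : nat) : X x -> submonoid_gen X x.
Proof. by move=> Xx M [_ XM]; exact: XM. Qed.

Lemma submonoid_gen0 (X : set nat) : submonoid_gen X 0.
Proof. by move=> M [[M0 _] _]. Qed.

Lemma submonoid_genD (X : set nat) (x y : nat) :
  submonoid_gen X x -> submonoid_gen X y -> submonoid_gen X (x + y).
Proof.
move=> Sx Sy M MX; have [[_ MD] _] := MX.
by apply: MD; [exact: Sx | exact: Sy].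
Qed.

(** Induction on [t], splitting off one generator [4 * k + 7 + 2 * u]. The choice of [u] must leave
    a remainder that is admissible for one summand fewer, so it has to avoid the exceptional pair
    [(1, 2)]. *)
Lemma sgS_admissible (k t w : nat) :
  admissible t w -> sgS k (t * (4 * k + 7) + 2 * w).
Proof.
have step u t' w' x : sgS k (4 * k + 7 + 2 * u) ->
    sgS k (t' * (4 * k + 7) + 2 * w') ->
    x = t'.+1 * (4 * k + 7) + 2 * (u + w') -> sgS k x.
  move=> Su Sw ->; have -> : t'.+1 * (4 * k + 7) + 2 * (u + w') =
    (4 * k + 7 + 2 * u) + (t' * (4 * k + 7) + 2 * w') by lia.
  exact: submonoid_genD.
have gen (u : nat) : u \in [:: 0; 1; 3; 4] -> sgS k (4 * k + 7 + 2 * u).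
  rewrite !inE => Hu; apply: submonoid_gen_incl => /=.
  case/or4P: Hu => /eqP ->.
  - by left; left; left; lia.
  - by left; left; right; lia.
  - by left; right; lia.
  - by right; lia.
elim: t w => [|t IH] w [wt nw].
  have -> : w = 0 by lia.
  exact: submonoid_gen0.
have [-> | [u [w' [Hu [-> adm]]]]] : w = 0 \/ exists (u w' : nat),
    u \in [:: 0; 1; 3; 4] /\ w = u + w' /\ admissible t w'.
- rewrite /admissible; case: w wt nw => [|[|[|[|w]]]] wt nw.
  + by left.
  + by right; exists 1, 0; split => //; lia.
  + by right; exists 1, 1; split => //; lia.
  + by right; exists 3, 0; split => //; lia.
  (* Here [w] is what remains after taking away 4. Removing [u = 4] from 6 would leave 2, which is
     not admissible when [t = 1]; so 6 is split as 3 + 3. *)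
  + right; have [w2|w2] := eqVneq w 2.
      by exists 3, 3; split => //; lia.
    by exists 4, w; split => //; lia.
- by apply: (step 0 t 0) => //; [exact: gen | apply: IH; split; lia].
- by apply: (step u t w') => //; [exact: gen | exact: IH].
Qed.

Lemma sgSP (k n : nat) : sgS k n <->
  exists t w, admissible t w /\ n = t * (4 * k + 7) + 2 * w.
Proof.
split; last by move=> [t [w [adm ->]]]; exact: sgS_admissible.
move=> Sn; apply: (Sn [set x | exists t w, admissible t w /\
  x = t * (4 * k + 7) + 2 * w]); split.
- split; first by exists 0, 0; rewrite /admissible; lia.
  move=> x y [t [w [adm ->]]] [t' [w' [adm' ->]]].
  (* The exception survives addition: [t + t' = 1] forces one of the two pairs to be [(0, 0)], so
     the other would already be [(1, 2)]. *)
  exists (t + t'), (w + w'); rewrite /admissible in adm adm' *.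
  by split; lia.
- move=> x /= [[[|]|]|] ->; rewrite /admissible.
  + by exists 1, 0; lia.
  + by exists 1, 1; lia.
  + by exists 1, 3; lia.
  + by exists 1, 4; lia.
Qed.

Lemma CsetE (k a b c : nat) : Cset k (a, b, c) <->
  [\/ a = 1 /\ b = 0 /\ c <= k + 1,
      a = 2 /\ b = 0 /\ c = 0,
      a = 0 /\ (b = 1 \/ b = 2) /\ c <= k |
      a = 0 /\ b = 0 /\ c <= k + 1].
Proof.
rewrite /Cset /Ca /Cb /Cc; split.
- move=> [[[[[/= ? ?] ?]|[? ? ?]]|[[/= ? ?] ?]]|[[/= ? ?] ?]].
  + by apply: Or41.
  + by apply: Or42.
  + by apply: Or43.
  + by apply: Or44.
- move=> [[-> [-> cle]]|[-> [-> ->]]|[-> [b12 cle]]|[-> [-> cle]]].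
  + by left; left; left.
  + by left; left; right.
  + by left; right.
  + by right.
Qed.

(** Comparing with the predecessor of [t] is enough, since admissibility of [w] is preserved when
    [t] grows. For [t = 0] the last condition is vacuous. *)
Definition minimal (k t w : nat) : Prop :=
  [/\ w < 4 * k + 7, admissible t w & forall t', t = t'.+1 -> ~ admissible t' w].

(** The residue of [w] modulo 4 selects the family of [(a, b, c)], and [w < 4 * k + 7] yields the
    bounds on [c]: [k + 1] when [w] is [4 * c] or [1 + 4 * c], but [k] when it is [3 + 4 * c] or
    [6 + 4 * c]. *)
Lemma minimal_Cset (k t w : nat) : minimal k t w <->
  exists a b c, [/\ Cset k (a, b, c), t = a + b + c & w = a + 3 * b + 4 * c].
Proof.
rewrite /minimal /admissible; split.
- move=> [wm adm mint].
  suff [a [b [c [tE wE abc]]]] : exists a b c,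
      [/\ t = a + b + c, w = a + 3 * b + 4 * c &
          (a = 1 /\ b = 0) \/ (a = 2 /\ b = 0 /\ c = 0) \/
          (a = 0 /\ b <= 2)].
    exists a, b, c; split => //; apply/CsetE.
    move: abc => [[? ?]|[[? [? ?]]|[a0 b2]]].
    + by apply: Or41; lia.
    + by apply: Or42; lia.
    + case: (posnP b) => [b0|b_gt0]; first by apply: Or44; lia.
      by apply: Or43; lia.
  case: t adm mint => [|t] adm mint; first by exists 0, 0, 0; split; lia.
  have {}mint := mint t erefl.
  (* The exclusion of [(1, 2)] raises the least [t] for [w = 2] to 2, whence the isolated triple
     [(2, 0, 0)]. For other positive [w] the least [t] is [w / 4] rounded up. *)
  have [w2|w2] := eqVneq w 2; first by exists 2, 0, 0; split; lia.
  have : [\/ w = 4 * t + 1, w = 4 * t + 2, w = 4 * t + 3 | w = 4 * t + 4].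
    have : w = 4 * t + 1 \/ w = 4 * t + 2 \/ w = 4 * t + 3 \/ w = 4 * t + 4.
      by lia.
    by move=> [|[|[|]]] ?; [apply: Or41|apply: Or42|apply: Or43|apply: Or44].
  move=> [] ?.
  + by exists 1, 0, t; split; lia.
  (* Since [w] is not 2, [t] is positive, and [4 * t + 2 = 3 + 3 + 4 * (t - 1)]. *)
  + by exists 0, 2, t.-1; split; lia.
  + by exists 0, 1, t; split; lia.
  + by exists 0, 0, t.+1; split; lia.
- move=> [a [b [c [/CsetE abc -> ->]]]].
  by move: abc => [] abc; split=> [||t' t'E]; lia.
Qed.

Lemma minimal_Apery (k t w : nat) : minimal k t w ->
  Apery (sgS k) (4 * k + 7) (t * (4 * k + 7) + 2 * w).
Proof.
move=> [wm adm mint]; split; first exact: sgS_admissible.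
move=> [mle /sgSP [t' [w' [adm' E]]]].
have {mle} E : t * (4 * k + 7) + 2 * w = t'.+1 * (4 * k + 7) + 2 * w' by lia.
(* As [4 * k + 7] is odd, [t] and [t'.+1] differ by an even number. A difference of 1 is thus
   impossible, and [t'.+1 >= t + 2] would give [w >= 4 * k + 7]. *)
have [tt'|tt'|tt'] := ltngtP t t'.+1.
- have [d dE] : exists d, t'.+1 = t + d.+1 by exists (t' - t); lia.
  rewrite dE mulnDl in E.
  by case: d dE E => [|d] dE E; [lia | nia].
- have [d dE] : exists d, t = t'.+1 + d.+1 by exists (t - t'.+2); lia.
  rewrite dE mulnDl in E.
  case: d dE E => [|d] dE E; first by lia.
  have w'w : 4 * k + 7 + w <= w' by nia.
  case: t mint adm dE {tt' E} => [|t] mint adm dE; first by lia.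
  (* Now [w <= w' <= 4 * t'], and the predecessor of the original [t] is at least [t' + 2], so it is
     admissible for [w], against minimality. *)
  have := mint t erefl; move: adm adm'; rewrite /admissible; lia.
- apply: (mint t' tt'); suff -> : w = w' by [].
  by rewrite tt' in E; lia.
Qed.

Lemma Apery_minimal (k n : nat) : Apery (sgS k) (4 * k + 7) n ->
  exists t w, minimal k t w /\ n = t * (4 * k + 7) + 2 * w.
Proof.
move=> [/sgSP [t [w [adm ->]]] nS]; exists t, w; split=> //; split=> //.
(* If [w >= 4 * k + 7], trading [2 * (4 * k + 7)] out of [2 * w] pays for the subtracted [4 * k + 7]
   and for one more summand. The new pair is not [(1, 2)], because [t = 0] would force [w = 0]. *)
- rewrite ltnNge; apply/negP => mw; apply: nS; split; first by lia.
  have -> : t * (4 * k + 7) + 2 * w - (4 * k + 7) =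
    t.+1 * (4 * k + 7) + 2 * (w - (4 * k + 7)) by lia.
  by apply: sgS_admissible; move: adm; rewrite /admissible; lia.
- move=> t' tE adm'; apply: nS; split; first by rewrite tE; lia.
  have -> : t * (4 * k + 7) + 2 * w - (4 * k + 7) =
    t' * (4 * k + 7) + 2 * w by rewrite tE; lia.
  exact: sgS_admissible.
Qed.

Theorem theorem30 (k : nat) :
  Apery (sgS k) (4 * k + 7) =
  [set n | exists a b c : nat, Cset k (a, b, c) /\
     n = a * (4 * k + 9) + b * (4 * k + 13) + c * (4 * k + 15)].
Proof.
apply/seteqP; split => n /=.
- move=> /Apery_minimal [t [w [/minimal_Cset [a [b [c [abc -> ->]]]] ->]]].
  by exists a, b, c; split=> //; lia.
- move=> [a [b [c [abc ->]]]].
  have -> : a * (4 * k + 9) + b * (4 * k + 13) + c * (4 * k + 15) =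
    (a + b + c) * (4 * k + 7) + 2 * (a + 3 * b + 4 * c) by lia.
  by apply/minimal_Apery/minimal_Cset; exists a, b, c.
Qed.
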